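(* For every integer $n\ge0$, the cyclotomic polynomial $\Phi_3(w)$ divides $\operatorname{o-rank}_{3n+2}(w)$ in $\mathbb{Z}[w,w^{-1}]$.
   Context: $\Phi_\ell(w)$ denotes the $\ell$-th cyclotomic polynomial. A Laurent polynomial $\Phi(w)$ divides $f(w)$ in $\mathbb{Z}[w,w^{-1}]$ if $f=g\Phi$ for some $g\in\mathbb{Z}[w,w^{-1}]$. Write $(a;q)_n=\prod_{k=0}^{n-1}(1-aq^k)$. The overpartition pair rank polynomials $\operatorname{o-rank}_n(w)\in\mathbb{Z}[w,w^{-1}]$ ($n\ge0$) are the $q$-series coefficients $$\sum_{n\ge0}\operatorname{o-rank}_n(w)q^n=\sum_{n\ge0}\frac{(-1;q)_n^2\,q^n}{(wq;q)_n(w^{-1}q;q)_n}.$$ (Combinatorially, $\operatorname{o-rank}_n(w)=\sum_{m\in\mathbb{Z}}\overline{NN}(m,n)w^m$, where $\overline{NN}(m,n)$ is the number of overpartition pairs $(\lambda,\mu)$ of $n$ with rank $m$. An overpartition is a partition in which the first occurrence of each part may be overlined. The rank of $(\lambda,\mu)$ is $\ell((\lambda,\mu))-n(\lambda)-\overline{n}(\mu)-\chi((\lambda,\mu))$, with $\ell$ the largest part, $n(\cdot)$ the number of parts, $\overline{n}(\cdot)$ the number of overlined parts, and $\chi=1$ if the largest part of the pair is non-overlined and in $\mu$, and $\chi=0$ otherwise.) *)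

(* Defs.v *)
From HB Require Import structures.
From mathcomp Require Import all_boot all_order all_algebra all_field.
From mathcomp Require Import boolp.

Set Implicit Arguments.
Unset Strict Implicit.
Unset Printing Implicit Defensive.
Import GRing.Theory.
Local Open Scope ring_scope.

Local Notation "x %:F" := (tofrac x).

(* Z[w, w^-1], realized as the subring of Frac(Z[w]) of the fractions that
   become polynomials after multiplication by some power of w. *)
Definition is_laurent : {pred {fraction {poly int}}} :=
  fun x => `[< exists k (p : {poly int}), x * ('X%:F) ^+ k = p%:F >].

Lemma is_laurent_subring : subring_closed is_laurent.
Proof.
split.
- by apply/asboolP; exists 0%N, 1; rewrite expr0 mulr1 rmorph1.
- move=> x y /asboolP[k [p xE]] /asboolP[l [r yE]]; apply/asboolP.
  exists (k + l)%N, (p * 'X^l - r * 'X^k).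
  by rewrite rmorphB !rmorphM !rmorphXn /= -xE -yE exprD mulrBl mulrA
             [_ ^+ k * _ in X in _ - X]mulrC mulrA.
- move=> x y /asboolP[k [p xE]] /asboolP[l [r yE]]; apply/asboolP.
  by exists (k + l)%N, (p * r); rewrite rmorphM /= -xE -yE exprD mulrACA.
Qed.

Record laurent := Laurent {
  laurent_val : {fraction {poly int}};
  laurent_valP : laurent_val \in is_laurent }.

HB.instance Definition _ := [isSub for laurent_val].
HB.instance Definition _ := [Choice of laurent by <:].
HB.instance Definition _ := GRing.SubChoice_isSubComNzRing.Build
  {fraction {poly int}} is_laurent laurent is_laurent_subring.

Definition laurent_unit : {pred laurent} :=
  fun x => (val x != 0) && ((val x)^-1 \in is_laurent).
Definition laurent_inv (x : laurent) : laurent := insubd x (val x)^-1.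

Lemma laurent_mulVx :
  {in laurent_unit, left_inverse 1 laurent_inv *%R}.
Proof.
move=> x /andP[x0 xV]; apply: val_inj.
by rewrite rmorphM rmorph1 /= val_insubd xV mulVf.
Qed.

Lemma laurent_unitPl (x y : laurent) : y * x = 1 -> laurent_unit x.
Proof.
move=> /(congr1 val); rewrite rmorphM rmorph1 /= => yx1.
have x0 : val x != 0.
  by apply: contra_eq_neq yx1 => ->; rewrite mulr0 eq_sym oner_neq0.
apply/andP; split=> //; suff -> : (val x)^-1 = val y by exact: valP.
by rewrite -[RHS](mulfK x0) yx1 mul1r.
Qed.

Lemma laurent_inv_out : {in [predC laurent_unit], laurent_inv =1 id}.
Proof.
move=> x; rewrite inE /= => nx; apply: val_inj; rewrite /= val_insubd.
case: ifP => // xV; move: nx; rewrite -topredE /= /laurent_unit xV andbT negbK.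
by move=> /eqP ->; rewrite invr0.
Qed.

HB.instance Definition _ := GRing.ComNzRing_hasMulInverse.Build laurent
  laurent_mulVx laurent_unitPl laurent_inv_out.

Lemma wvar_subproof : 'X%:F \in is_laurent.
Proof. by apply/asboolP; exists 0%N, 'X; rewrite expr0 mulr1. Qed.

Definition wvar : laurent := Laurent wvar_subproof.

Lemma wvar_unit : wvar \is a GRing.unit.
Proof.
have X0 : ('X : {poly int})%:F != 0 by rewrite tofrac_eq0 polyX_eq0.
apply/andP; split=> //; apply/asboolP; exists 1%N, 1.
by rewrite expr1 mulVf // rmorph1.
Qed.

Lemma laurentP (x : laurent) :
  exists k (p : {poly int}), x * wvar ^+ k = (map_poly intr p).[wvar].
Proof.
have pE (p : {poly int}) : val (map_poly intr p).[wvar] = p%:F.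
  elim/poly_ind: p => [|p c IHp]; first by rewrite !rmorph0 horner0 rmorph0.
  have -> : (map_poly intr (p * 'X + c%:P)).[wvar] =
      (map_poly intr p).[wvar] * wvar + c%:~R.
    by rewrite rmorphD rmorphM /= map_polyX map_polyC /= hornerMXaddC.
  have cE : val (c%:~R : laurent) = c%:P%:F.
    by rewrite rmorph_int -[in RHS](intz c) !rmorph_int.
  rewrite [LHS]rmorphD [RHS]rmorphD; congr (_ + _); last exact: cE.
  by rewrite [LHS]rmorphM [RHS]rmorphM; congr (_ * _); exact: IHp.
have [k [p xE]] := asboolW (valP x); exists k, p; apply: val_inj.
by rewrite pE -xE rmorphM rmorphXn.
Qed.

(* Formal power series in q: the series with coefficients f 0, f 1, ... *)
Record fps (R : Type) := Fps { coefs : nat -> R }.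

Lemma fpsP (R : Type) (f g : fps R) : coefs f =1 coefs g -> f = g.
Proof. by case: f g => [f] [g] /= /funext ->. Qed.

HB.instance Definition _ (R : Type) := gen_eqMixin (fps R).
HB.instance Definition _ (R : Type) := gen_choiceMixin (fps R).

Section FpsRing.
Variable R : comNzRingType.
Implicit Types f g h : fps R.

Definition fps0 : fps R := Fps (fun _ => 0).
Definition fps_opp f := Fps (fun n => - coefs f n).
Definition fps_add f g := Fps (fun n => coefs f n + coefs g n).
Definition fpsC (c : R) : fps R := Fps (fun n => if n == 0%N then c else 0).
Definition fps_mul f g :=
  Fps (fun n => \sum_(i < n.+1) coefs f i * coefs g (n - i)%N).

Fact fps_addA : associative fps_add.
Proof. by move=> f g h; apply: fpsP => n /=; rewrite addrA. Qed.
Fact fps_addC : commutative fps_add.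
Proof. by move=> f g; apply: fpsP => n /=; rewrite addrC. Qed.
Fact fps_add0 : left_id fps0 fps_add.
Proof. by move=> f; apply: fpsP => n /=; rewrite add0r. Qed.
Fact fps_addN : left_inverse fps0 fps_opp fps_add.
Proof. by move=> f; apply: fpsP => n /=; rewrite addNr. Qed.

HB.instance Definition _ := GRing.isZmodule.Build (fps R)
  fps_addA fps_addC fps_add0 fps_addN.

Let trunc m f : {poly R} := \poly_(i < m.+1) coefs f i.

Let coef_mul_trunc m n f g : (n <= m)%N ->
  coefs (fps_mul f g) n = (trunc m f * trunc m g)`_n.
Proof.
move=> nm; rewrite coefM /=; apply: eq_bigr => i _.
have im : (i <= m)%N by rewrite (leq_trans _ nm) // -ltnS.
by rewrite !coef_poly !ltnS im (leq_trans (leq_subr _ _) nm).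
Qed.

Fact fps_mulA : associative fps_mul.
Proof.
move=> f g h; apply: fpsP => n.
transitivity (trunc n f * (trunc n g * trunc n h))`_n; last first.
  rewrite mulrA coefM /=; apply: eq_bigr => i _.
  by rewrite -(coef_mul_trunc (m := n)) -1?ltnS // coef_poly ltnS leq_subr.
rewrite coefM /=; apply: eq_bigr => i _.
by rewrite -(coef_mul_trunc (m := n)) ?leq_subr // coef_poly ltn_ord.
Qed.

Fact fps_mulC : commutative fps_mul.
Proof.
by move=> f g; apply: fpsP => n; rewrite !(coef_mul_trunc _ _ (leqnn n)) mulrC.
Qed.

Fact fps_mul1 : left_id (fpsC 1) fps_mul.
Proof.
move=> f; apply: fpsP => n /=; rewrite big_ord_recl /= mul1r subn0.
by rewrite big1 ?addr0 // => i _; rewrite mul0r.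
Qed.

Fact fps_mulDl : left_distributive fps_mul fps_add.
Proof.
move=> f g h; apply: fpsP => n /=; rewrite -big_split /=.
by apply: eq_bigr => i _; rewrite mulrDl.
Qed.

Fact fps_oner_neq0 : fpsC 1 != fps0.
Proof.
by apply/eqP => /(congr1 (fun f => coefs f 0%N)) /eqP; rewrite /= oner_eq0.
Qed.

HB.instance Definition _ := GRing.Zmodule_isComNzRing.Build (fps R)
  fps_mulA fps_mulC fps_mul1 fps_mulDl fps_oner_neq0.

Definition qvar : fps R := Fps (fun n => (n == 1%N)%:R).

Lemma coefs0 n : coefs (0 : fps R) n = 0. Proof. by []. Qed.
Lemma coefs1 n : coefs (1 : fps R) n = (n == 0%N)%:R. Proof. by case: n. Qed.
Lemma coefsN f n : coefs (- f) n = - coefs f n. Proof. by []. Qed.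
Lemma coefsD f g n : coefs (f + g) n = coefs f n + coefs g n.
Proof. by []. Qed.
Lemma coefsB f g n : coefs (f - g) n = coefs f n - coefs g n.
Proof. by []. Qed.
Lemma coefsM f g n :
  coefs (f * g) n = \sum_(i < n.+1) coefs f i * coefs g (n - i)%N.
Proof. by []. Qed.
Lemma coefs0M f g : coefs (f * g) 0%N = coefs f 0%N * coefs g 0%N.
Proof. by rewrite coefsM big_ord1. Qed.
Lemma coefs_sum I (r : seq I) (P : pred I) (F : I -> fps R) n :
  coefs (\sum_(i <- r | P i) F i) n = \sum_(i <- r | P i) coefs (F i) n.
Proof. exact: (big_morph (fun f => coefs f n)). Qed.

Definition qdiv k f := forall i, (i < k)%N -> coefs f i = 0.

Lemma qdivM k l f g : qdiv k f -> qdiv l g -> qdiv (k + l) (f * g).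
Proof.
move=> kf lg n nkl; rewrite coefsM big1 // => i _.
have [ik|ki] := ltnP i k; first by rewrite kf ?mul0r.
rewrite lg ?mulr0 // -(ltn_add2r i) subnK; last by rewrite -ltnS.
by rewrite (leq_trans nkl) // addnC leq_add2l.
Qed.

Lemma qdivX k f : qdiv 1 f -> qdiv k (f ^+ k).
Proof.
move=> f1; elim: k => [|k IHk]; first by [].
by rewrite exprS; apply: (qdivM (k := 1)).
Qed.

Lemma qdiv_qvarX k : qdiv k (qvar ^+ k).
Proof. by apply: qdivX => -[]. Qed.

Lemma eq_coefsM f g h n : (forall i, (i <= n)%N -> coefs g i = coefs h i) ->
  coefs (f * g) n = coefs (f * h) n.
Proof. by move=> gh; apply: eq_bigr => i _; rewrite gh ?leq_subr. Qed.

(* The sum of a series whose n-th term is divisible by q^n; then the terms of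
   index above N do not contribute to the coefficient of q^N. *)
Definition fps_sum (F : nat -> fps R) : fps R :=
  Fps (fun N => coefs (\sum_(n < N.+1) F n) N).

Lemma coefs_fps_sum F N M : (forall n, qdiv n (F n)) -> (N < M)%N ->
  coefs (fps_sum F) N = coefs (\sum_(n < M) F n) N.
Proof.
move=> qF NM; rewrite /= -(subnKC NM) big_split_ord coefsD /= addrC.
rewrite [X in X + _](_ : _ = 0) ?add0r // coefs_sum big1 // => i _.
by rewrite qF //= ltnS leq_addr.
Qed.

End FpsRing.

Arguments qvar {R}.

Section FpsUnit.
Variable R : comUnitRingType.
Implicit Types f g : fps R.

Definition fps_unit : {pred fps R} := fun f => coefs f 0%N \is a GRing.unit.

(* 1 / f = c^-1 * \sum_n (1 - c^-1 f)^n, where c is the constant term of f. *)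
Definition fps_inv f : fps R :=
  if f \in fps_unit then
    let c := fpsC (coefs f 0%N)^-1 in
    c * fps_sum (fun n => (1 - c * f) ^+ n)
  else f.

Fact fps_mulVx : {in fps_unit, left_inverse 1 fps_inv *%R}.
Proof.
move=> f uf; rewrite /fps_inv uf; set c := fpsC _; set h := 1 - c * f.
have h1 : qdiv 1 h.
  by case=> // _; rewrite coefsB coefs1 coefs0M /= mulVr ?subrr.
rewrite mulrAC; have -> : c * f = 1 - h by rewrite /h opprB addrC subrK.
apply: fpsP => N; rewrite (@eq_coefsM _ _ _ (\sum_(n < N.+1) h ^+ n)).
  rewrite -(big_mkord predT (fun n => h ^+ n)) big_mkord -[1 - h]opprB mulNr.
  by rewrite -subrX1 opprB coefsB (qdivX h1) ?subr0.
by move=> i iN; apply: coefs_fps_sum => // n; apply: qdivX.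
Qed.

Fact fps_unitPl f g : g * f = 1 -> fps_unit f.
Proof.
move=> /(congr1 (fun h => coefs h 0%N)); rewrite coefs0M coefs1 /= => gf.
by apply/unitrPr; exists (coefs g 0%N); rewrite mulrC.
Qed.

Fact fps_inv_out : {in [predC fps_unit], fps_inv =1 id}.
Proof. by move=> f; rewrite inE /= /fps_inv => /negPf ->. Qed.

HB.instance Definition _ := GRing.ComNzRing_hasMulInverse.Build (fps R)
  fps_mulVx fps_unitPl fps_inv_out.

End FpsUnit.

(* (a; q)_n *)
Definition qpoch (A : comNzRingType) (a q : A) (n : nat) : A :=
  \prod_(k < n) (1 - a * q ^+ k).

Definition orank_term (n : nat) : fps laurent :=
  (qpoch (-1) qvar n) ^+ 2 * qvar ^+ n /
  (qpoch (fpsC wvar * qvar) qvar n * qpoch (fpsC wvar^-1 * qvar) qvar n).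

Definition orank_gf : fps laurent := fps_sum orank_term.

Definition orank (n : nat) : laurent := coefs orank_gf n.

(* The denominators in orank_term are units, so _^-1 is a true inverse there. *)
Lemma qpoch_unit (R : comUnitRingType) (a : fps R) n :
  qpoch (a * qvar) qvar n \is a GRing.unit.
Proof.
rewrite /qpoch; elim/big_ind: _ => [|f g uf ug|k _]; rewrite ?unitr1 //.
  by rewrite unitrM uf ug.
suff : coefs (1 - a * qvar * qvar ^+ k) 0%N \is a GRing.unit by [].
by rewrite coefsB !coefs0M coefs1 /= mulr0 mul0r subr0 unitr1.
Qed.

Lemma orank_term_qdiv n : qdiv n (orank_term n).
Proof.
rewrite /orank_term mulrAC mulrC -[n in qdiv n]addn0.
by apply: qdivM => //; apply: qdiv_qvarX.
Qed.

Lemma orank_gfE N M : (N < M)%N ->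
  orank N = coefs (\sum_(n < M) orank_term n) N.
Proof. by apply: coefs_fps_sum; apply: orank_term_qdiv. Qed.

Definition laurent_dvd (d f : laurent) : Prop := exists g : laurent, f = g * d.

(* Main.v *)
(* Let [t_n = (x;q)_n (1/x;q)_n / ((wq;q)_n (q/w;q)_n)].  Since
   [(1 - x q^n)(1 - q^n/x) - (1 - w q^n)(1 - q^n/w) = (w + 1/w - x - 1/x) q^n],
   the series [(w + 1/w - x - 1/x) \sum_n t_n q^n] telescopes.  At [x = -1] and
   modulo [Phi_3(w)], where [w + 1/w = -1], this gives the generating function
   [-3 + 4 \prod_k (1 + q^k)^2 (1 - q^k) / (1 - q^(3k))].  By Gauss the
   numerator is [\sum_s q^(s(s+1)/2)], the denominator is a series in [q^3], and
   no triangular number is [2] modulo [3].  Infinite products are replaced by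
   partial products modulo a power of [q]. *)
Require Import Defs.
From mathcomp Require Import all_boot all_order all_algebra all_field.
From mathcomp Require Import ring zify.
Import GRing.Theory.
Local Open Scope ring_scope.

(** * Finite products in q and triangular numbers *)

Section FiniteProducts.
Variables (A : comNzRingType) (q : A).

(* Shanks: modulo [q^(2n+1)] only the term [s = 0] survives on the left, which
   is a truncation of the Gauss identity for triangular numbers. *)
Lemma shanks_gauss n :
  \sum_(s < n) \prod_(s <= k < n) (1 - q ^+ (2 * k.+1)) *
    \prod_(k < s) (1 - q ^+ (2 * k).+1) * q ^+ (s * (2 * n).+1) =
  \prod_(k < n) (1 - q ^+ (2 * k).+1) * \sum_(s < 2 * n) q ^+ (s * s.+1)./2.
Proof.
elim: n => [|n IHn]; first by rewrite !big_ord0 mulr0.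
(* Telescoping certificate: replacing [n] by [n.+1] multiplies the [s]-th summand by 1 - q^(2n+1)
   and adds [H s.+1 - H s]. The factor 1 - q^(2s) makes [H 0] vanish. *)
pose H s := \prod_(s <= k < n) (1 - q ^+ (2 * k.+1)) *
  \prod_(k < s) (1 - q ^+ (2 * k).+1) * (1 - q ^+ (2 * s)) *
  q ^+ (s * (2 * n).+1).
have q2n2 : q ^+ (2 * n.+1) = q ^+ (2 * n).+1 * q by rewrite -exprSr mulnS.
have triE : \sum_(s < 2 * n.+1) q ^+ (s * s.+1)./2 =
    \sum_(s < 2 * n) q ^+ (s * s.+1)./2 +
    q ^+ (n * (2 * n).+1) * (1 + q ^+ (2 * n).+1).
  rewrite mulnS add2n 2!big_ord_recr /= -addrA mulrDr mulr1 -exprD.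
  by congr (_ + (q ^+ _ + q ^+ _)); nia.
have termE (s : 'I_n) : \prod_(s <= k < n.+1) (1 - q ^+ (2 * k.+1)) *
    \prod_(k < s) (1 - q ^+ (2 * k).+1) * q ^+ (s * (2 * n.+1).+1) =
    (1 - q ^+ (2 * n).+1) * (\prod_(s <= k < n) (1 - q ^+ (2 * k.+1)) *
    \prod_(k < s) (1 - q ^+ (2 * k).+1) * q ^+ (s * (2 * n).+1)) +
    (H s.+1 - H s).
  have sn := ltn_ord s; rewrite /H big_nat_recr ?(ltnW sn) //=.
  rewrite [\prod_(k < s.+1) _]big_ord_recr /= (big_ltn sn).
  have -> : q ^+ (s * (2 * n.+1).+1) = q ^+ (s * (2 * n).+1) * q ^+ (2 * s).
    by rewrite -exprD; congr (q ^+ _); lia.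
  have -> : q ^+ (s.+1 * (2 * n).+1) = q ^+ (s * (2 * n).+1) * q ^+ (2 * n).+1.
    by rewrite -exprD; congr (q ^+ _); lia.
  have -> : q ^+ (2 * s.+1) = q ^+ (2 * s) * q * q by rewrite -!exprSr mulnS.
  by rewrite q2n2 (exprSr q (2 * s)); ring.
rewrite big_ord_recr (eq_bigr _ (fun s _ => termE s)) big_split /=.
rewrite -mulr_sumr IHn -(big_mkord predT (fun s => H s.+1 - H s)).
rewrite telescope_sumr // /H triE.
rewrite !(big_geq (leqnn n)) big_nat1 muln0 expr0 big_ord_recr /=.
have -> : q ^+ (n * (2 * n.+1).+1) = q ^+ (n * (2 * n).+1) * q ^+ (2 * n).
  by rewrite -exprD; congr (q ^+ _); lia.
by rewrite q2n2 (exprSr q (2 * n)); ring.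
Qed.

(** Finite form of Euler's theorem on odd and distinct parts: the right side is 1 modulo q^(n+1). *)
Lemma euler_odd_distinct n :
  \prod_(k < n) (1 + q ^+ k.+1) * \prod_(k < n) (1 - q ^+ (2 * k).+1) =
  \prod_(n <= k < 2 * n) (1 - q ^+ k.+1).
Proof.
elim: n => [|n IHn]; first by rewrite !big_ord0 big_geq // mul1r.
have n2n : (n <= 2 * n)%N by lia.
rewrite !big_ord_recr /= mulrACA IHn mulnS add2n big_nat_recr ?ltnS //=.
(* The factor 1 - q^(n+1) that leaves the range combines with 1 + q^(n+1) into the new top factor 1
   - q^(2n+2). *)
have := big_ltn (n2n : (n < (2 * n).+1)%N) (idx := 1) (op := *%R)
  (F := fun k => 1 - q ^+ k.+1).
rewrite big_nat_recr //= => e.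
have -> : q ^+ (2 * n).+2 = q ^+ n.+1 * q ^+ n.+1.
  by rewrite -exprD; congr (q ^+ _); lia.
by rewrite mulrCA mulrC e; ring.
Qed.

(** Multiply [shanks_gauss] by the product of the 1 + q^k: Euler removes the odd product on the
    right, and on the left (1 + q^k)(1 - q^(2k)) = (1 + q^k)^2 (1 - q^k). *)
Lemma gauss_triangular_mod n : exists h,
  \prod_(k < n.+1) ((1 + q ^+ k.+1) ^+ 2 * (1 - q ^+ k.+1)) =
  \sum_(s < 2 * n.+1) q ^+ (s * s.+1)./2 + q ^+ n.+2 * h.
Proof.
have prod1 (I : eqType) (r : seq I) (a : I -> A) :
    exists h, \prod_(i <- r) (1 - q ^+ n.+2 * a i) = 1 + q ^+ n.+2 * h.
  elim/big_ind: _ => [|x y [h ->] [h' ->]|i _].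
  - by exists 0; rewrite mulr0 addr0.
  - by exists (h + h' + q ^+ n.+2 * h * h'); ring.
  - by exists (- a i); rewrite mulrN.
have [h hE] : exists h, \prod_(k < n.+1) (1 + q ^+ k.+1) *
    \prod_(k < n.+1) (1 - q ^+ (2 * k).+1) = 1 + q ^+ n.+2 * h.
  rewrite euler_odd_distinct.
  rewrite (eq_big_nat _ _ (F2 := fun k => 1 - q ^+ n.+2 * q ^+ (k - n.+1))).
    exact: prod1.
  by move=> k /andP[nk _]; rewrite -exprD; congr (1 - q ^+ _); lia.
(* The terms of positive index s carry q^(s(2n+3)), and s(2n+3) >= n+2. *)
have [r rE] : exists r, \sum_(s < n)
    \prod_(s.+1 <= k < n.+1) (1 - q ^+ (2 * k.+1)) *
    \prod_(k < s.+1) (1 - q ^+ (2 * k).+1) * q ^+ (s.+1 * (2 * n.+1).+1) =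
    q ^+ n.+2 * r.
  elim/big_ind: _ => [|x y [r ->] [r' ->]|s _].
  - by exists 0; rewrite mulr0.
  - by exists (r + r'); rewrite mulrDr.
  - have -> : (s.+1 * (2 * n.+1).+1 = n.+2 + (s.+1 * (2 * n.+1).+1 - n.+2))%N.
      by nia.
    by eexists; rewrite exprD mulrCA.
have := shanks_gauss n.+1.
rewrite [\sum_(s < n.+1) _]big_ord_recl /= big_ord0 mulr1 mul0n expr0 mulr1.
rewrite big_mkord rE => gE.
exists (h * \sum_(s < 2 * n.+1) q ^+ (s * s.+1)./2 -
  \prod_(k < n.+1) (1 + q ^+ k.+1) * r).
transitivity (\prod_(k < n.+1) (1 + q ^+ k.+1) *
    \prod_(k < n.+1) (1 - q ^+ (2 * k.+1))).
  rewrite -big_split; apply: eq_bigr => k _ /=.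
  by rewrite mulnC exprM; ring.
move/(canRL (addrK _)): gE => ->.
rewrite mulrBr mulrA hE; ring.
Qed.

End FiniteProducts.

(** * The telescoping sum *)

(** Each term is U_(m+1) - U_m with U_m = (x)_m (x')_m / ((zq)_(m-1) (z'q)_(m-1)); the constant (1 -
    z)(1 - z') is U_0. *)
Lemma qpoch_telescope (A : comUnitRingType) (q x x' z z' : A) n :
  x * x' = 1 -> z * z' = 1 ->
  (forall m, qpoch (z * q) q m \is a GRing.unit) ->
  (forall m, qpoch (z' * q) q m \is a GRing.unit) ->
  (z + z' - x - x') * \sum_(m < n.+1) qpoch x q m * qpoch x' q m * q ^+ m /
    (qpoch (z * q) q m * qpoch (z' * q) q m) =
  qpoch x q n.+1 * qpoch x' q n.+1 / (qpoch (z * q) q n * qpoch (z' * q) q n)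
    - (1 - z) * (1 - z').
Proof.
move=> xx' zz' uz uz'; set c := (1 - z) * (1 - z').
have quad (a b Q : A) : a * b = 1 ->
    (1 - a * Q) * (1 - b * Q) = 1 - (a + b) * Q + Q ^+ 2.
  move=> ab; transitivity (1 - (a + b) * Q + a * b * Q ^+ 2); first by ring.
  by rewrite ab mul1r.
elim: n => [|n IHn].
  have := quad _ _ 1 xx'; have := quad _ _ 1 zz'; rewrite !mulr1 => zE xE.
  rewrite big_ord1 /c zE /qpoch !big_ord0 !big_ord1 expr0 !mulr1 xE !divr1.
  by ring.
rewrite big_ord_recr /= mulrDr IHn.
rewrite ![qpoch x q n.+2]big_ord_recr ![qpoch x' q n.+2]big_ord_recr /=.
rewrite -/(qpoch x q n.+1) -/(qpoch x' q n.+1).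
set P := qpoch x q n.+1; set P' := qpoch x' q n.+1.
pose E m := qpoch (z * q) q m * qpoch (z' * q) q m.
rewrite -/(E n) -/(E n.+1).
have EE : E n.+1 = E n * (1 - (z + z') * q ^+ n.+1 + (q ^+ n.+1) ^+ 2).
  rewrite -(quad _ _ _ zz') /E /qpoch !big_ord_recr /= exprS !mulrA; ring.
have uE m : E m \is a GRing.unit by rewrite unitrM uz uz'.
have -> : P * P' / E n =
    P * P' * (1 - (z + z') * q ^+ n.+1 + (q ^+ n.+1) ^+ 2) / E n.+1.
  by apply: (mulIr (uE n.+1)); rewrite divrK // EE mulrA divrK.
have -> : P * (1 - x * q ^+ n.+1) * (P' * (1 - x' * q ^+ n.+1)) =
    P * P' * (1 - (x + x') * q ^+ n.+1 + (q ^+ n.+1) ^+ 2).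
  by rewrite -(quad _ _ _ xx'); ring.
ring.
Qed.

(** * Coefficients of power series *)

Section Coefficients.
Variable R : comNzRingType.
Implicit Types (f g : fps R) (c : R).

Lemma coefsCM c f n : coefs (fpsC c * f) n = c * coefs f n.
Proof.
rewrite coefsM big_ord_recl /= subn0 big1 ?addr0 // => i _.
by rewrite mul0r.
Qed.

Lemma fpsCM a b : fpsC (a * b) = fpsC a * fpsC b :> fps R.
Proof. by apply: fpsP => n; rewrite coefsCM /=; case: eqP; rewrite ?mulr0. Qed.

Lemma fpsCD a b : fpsC (a + b) = fpsC a + fpsC b :> fps R.
Proof. by apply: fpsP => n; rewrite coefsD /=; case: eqP; rewrite ?addr0. Qed.

Lemma coefs_qvarX k n : coefs (qvar ^+ k : fps R) n = (n == k)%:R.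
Proof.
elim: k n => [|k IHk] n; first by rewrite expr0 coefs1.
rewrite exprS coefsM; case: n => [|n]; first by rewrite big_ord1 mul0r.
rewrite !big_ord_recl /= mul0r add0r mul1r subSS subn0 IHk big1 ?addr0 //.
by move=> i _; rewrite mul0r.
Qed.

Lemma coefs_prod_sparse p n :
  let g := \prod_(k < n) (1 - qvar ^+ (p * k.+1)) : fps R in
  (0 < p)%N -> coefs g 0 = 1 /\ forall i, ~~ (p %| i)%N -> coefs g i = 0.
Proof.
move=> g p0; rewrite {}/g; elim/big_ind: _ => [|f g [f0 fs] [g0 gs]|k _].
- by split=> [|[|i]]; rewrite coefs1 ?dvdn0.
- split=> [|i pi]; first by rewrite coefs0M f0 g0 mulr1.
  rewrite coefsM big1 // => j _; have [pj|/fs->] := boolP (p %| j)%N.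
    rewrite gs ?mulr0 //; apply: contra pi => pij.
    by rewrite -(subnKC (ltn_ord j : j <= i)%N) dvdn_addr.
  by rewrite mul0r.
- split=> [|i pi]; rewrite coefsB coefs1 coefs_qvarX.
    by rewrite eq_sym muln_eq0 /= orbF eqn0Ngt p0 subr0.
  case: eqP pi => [->|_]; rewrite ?dvdn0 //.
  by case: eqP => [->|_]; rewrite ?dvdn_mulr ?subr0.
Qed.

End Coefficients.

(** * Divisibility of coefficients *)

Section LaurentDvd.
Variable d : laurent.

Lemma laurent_dvdM a b : laurent_dvd d a -> laurent_dvd d (a * b).
Proof. by case=> g ->; exists (b * g); ring. Qed.

Lemma laurent_dvdD a b :
  laurent_dvd d a -> laurent_dvd d b -> laurent_dvd d (a + b).
Proof. by case=> g -> [h ->]; exists (g + h); ring. Qed.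

Lemma laurent_dvdB a b :
  laurent_dvd d a -> laurent_dvd d b -> laurent_dvd d (a - b).
Proof. by case=> g -> [h ->]; exists (g - h); ring. Qed.

Lemma laurent_dvd0 : laurent_dvd d 0.
Proof. by exists 0; rewrite mul0r. Qed.

(** As [g] is a series in q^p, the coefficient of q^m in [f * g] involves [f] only at indices
    congruent to m. Constant term 1 then isolates [coefs f m], by strong induction. *)
Lemma laurent_dvd_coefs_factor p r N (f g : fps laurent) :
  coefs g 0 = 1 -> (forall i, ~~ (p %| i)%N -> coefs g i = 0) ->
  (forall m, (m <= N)%N -> (m %% p = r)%N -> laurent_dvd d (coefs (f * g) m)) ->
  forall m, (m <= N)%N -> (m %% p = r)%N -> laurent_dvd d (coefs f m).
Proof.
move=> g0 gs fg; elim/ltn_ind=> m IHm mN mr.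
have := fg m mN mr; rewrite coefsM big_ord_recr /= subnn g0 mulr1.
rewrite addrC => fgm; set S := \sum_(i < m) _ in fgm.
rewrite -(addrK S (coefs f m)); apply: laurent_dvdB fgm _; rewrite /S.
elim/big_ind: _ => [|x y|i _]; [exact: laurent_dvd0|exact: laurent_dvdD|].
have im := ltn_ord i.
have [pmi|/gs->] := boolP (p %| m - i)%N; last first.
  by rewrite mulr0; exact: laurent_dvd0.
apply/laurent_dvdM/IHm => //; first exact: leq_trans (ltnW im) mN.
by rewrite -mr -[in RHS](subnK (ltnW im)) -modnDml (eqP pmi).
Qed.

End LaurentDvd.

(** * Reduction modulo Phi_3(w) *)

Lemma Phi3E : (map_poly intr 'Phi_3).[wvar] = wvar ^+ 2 + wvar + 1.
Proof.
have -> : 'Phi_3 = 'X^2 + 'X + 1.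
  have X1 : 'X - 1 != 0 :> {poly int} by rewrite polyXsubC_eq0.
  have := @prod_Cyclotomic 3 isT.
  have := @prod_Cyclotomic 1 isT.
  rewrite (_ : divisors 3 = [:: 1; 3]%N) // (_ : divisors 1 = [:: 1]%N) //.
  rewrite !big_cons !big_nil !mulr1 => -> e; apply: (mulfI X1).
  rewrite e; ring.
by rewrite !rmorphD /= map_polyXn map_polyX rmorph1 !hornerE.
Qed.

(** Otherwise s(s+1) = 6b + 4 is 1 modulo 3, but s(s+1) is always 0 or 2. *)
Lemma triangular_mod3 s : ((s * s.+1)./2 %% 3 != 2)%N.
Proof.
apply/eqP => e.
have [a [r [r3 sE]]] : exists a r, (r < 3)%N /\ (s = 3 * a + r)%N.
  by exists (s %/ 3)%N, (s %% 3)%N; split; lia.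
have [b bE] : exists b, (s * s.+1 = 6 * b + 4)%N.
  exists ((s * s.+1)./2 %/ 3)%N.
  have : ~~ odd (s * s.+1) by rewrite oddM /=; case: (odd s).
  by move: (s * s.+1)%N e => t; lia.
have : (r = 0 \/ r = 1 \/ r = 2)%N by lia.
move: bE; rewrite sE => bE [|[|]] rE; move: bE; rewrite rE; nia.
Qed.

Lemma coefs_gauss (R : comNzRingType) n m : (m <= n)%N -> (m %% 3 = 2)%N ->
  coefs (\prod_(k < n) ((1 + qvar ^+ k.+1) ^+ 2 * (1 - qvar ^+ k.+1)) : fps R)
    m = 0.
Proof.
case: n => [|n]; first by rewrite leqn0 => /eqP->.
move=> mn m3; have [h ->] := gauss_triangular_mod (fps R) qvar n.
(* The error term starts at q^(n+2), beyond [m <= n.+1]. *)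
rewrite coefsD addrC (@qdivM _ n.+2 0 _ _ (@qdiv_qvarX _ _)) ?addn0 // add0r.
rewrite coefs_sum big1 // => s _; rewrite coefs_qvarX; case: eqP => // e.
by have := triangular_mod3 s; rewrite -e m3.
Qed.

Lemma fpsC_wvarV : fpsC wvar * fpsC wvar^-1 = 1.
Proof. by rewrite -fpsCM divrr ?wvar_unit. Qed.

Lemma fpsC_Phi3_wvarV :
  fpsC (wvar ^+ 2 + wvar + 1) * fpsC wvar^-1 = fpsC wvar + fpsC wvar^-1 + 1.
Proof.
rewrite !fpsCD expr2 fpsCM -[fpsC 1]/(1 : fps laurent) !mulrDl -mulrA.
by rewrite fpsC_wvarV mulr1 mul1r addrAC.
Qed.

(** With Q = q^(k+1), (1 - wQ)(1 - Q/w) = 1 - (w + 1/w)Q + Q^2, and w + 1/w is -1 modulo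
    Phi_3(w). *)
Lemma qpoch_Phi3_mod n : exists h,
  qpoch (fpsC wvar * qvar) qvar n * qpoch (fpsC wvar^-1 * qvar) qvar n =
  \prod_(k < n) (1 + qvar ^+ k.+1 + (qvar ^+ k.+1) ^+ 2) +
  fpsC (wvar ^+ 2 + wvar + 1) * h.
Proof.
set w := fpsC wvar; set w' := fpsC wvar^-1; set d := fpsC (_ + _ + _).
have ww' : w * w' = 1 := fpsC_wvarV.
have dE : d * w' = w + w' + 1 := fpsC_Phi3_wvarV.
rewrite /qpoch -big_split.
elim/big_ind2: _ => [|x0 _ y0 _ [h ->] [h' ->]|k _] /=.
- by exists 0; rewrite mulr0 addr0.
- by exists (x0 * h' + y0 * h + d * h * h'); ring.
- exists (- (w' * qvar ^+ k.+1)); rewrite mulrN mulrA dE exprS.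
  rewrite [LHS](_ : _ = 1 - (w + w') * (qvar * qvar ^+ k) +
    w * w' * (qvar * qvar ^+ k) ^+ 2); last by ring.
  by rewrite ww'; ring.
Qed.

Lemma orank_telescope n :
  (fpsC wvar + fpsC wvar^-1 + 1 + 1) * \sum_(k < n.+1) orank_term k =
  qpoch (-1) qvar n.+1 ^+ 2 / (qpoch (fpsC wvar * qvar) qvar n *
    qpoch (fpsC wvar^-1 * qvar) qvar n) -
  (1 - fpsC wvar) * (1 - fpsC wvar^-1).
Proof.
have N1 : (-1) * (-1) = 1 :> fps laurent by rewrite mulrNN mulr1.
have := @qpoch_telescope _ qvar _ _ _ _ n N1 fpsC_wvarV
  (fun k => qpoch_unit _ k) (fun k => qpoch_unit _ k).
rewrite !opprK -expr2 => <-; congr (_ * _).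
Qed.

Theorem theorem3p6 (n : nat) :
  laurent_dvd (map_poly intr 'Phi_3).[wvar] (orank (3 * n + 2)).
Proof.
rewrite Phi3E; have : ((3 * n + 2) %% 3 = 2)%N by lia.
move: (3 * n + 2)%N => m m3; set d := _ + 1; set D := fpsC d.
have dvdD (f : fps laurent) i : laurent_dvd d (coefs (D * f) i).
  by exists (coefs f i); rewrite coefsCM mulrC.
set w := fpsC wvar; set w' := fpsC wvar^-1.
have ww' : w * w' = 1 := fpsC_wvarV.
have DE : D * w' = w + w' + 1 := fpsC_Phi3_wvarV.
pose E := qpoch (w * qvar) qvar m * qpoch (w' * qvar) qvar m.
pose T := qpoch (-1) qvar m.+1 ^+ 2 / E.
pose S := \sum_(k < m.+1) orank_term k.
(* Here w + 1/w + 2 = 1 + D w' and (1 - w)(1 - 1/w) = 3 - D w', so the telescoped identity reads S =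
   T - 3 modulo D. *)
have SE : S = T - D * (w' * S - w') - (1 + 1 + 1).
  have := orank_telescope m; rewrite -/w -/w' -/E -/T -/S => tel.
  have -> : D * (w' * S - w') = (D * w') * S - D * w' by ring.
  rewrite DE; apply/eqP; rewrite -subr_eq0; apply/eqP.
  move/(canLR (subrK _)): tel => <-.
  rewrite [LHS](_ : _ = 1 - w * w'); first by rewrite ww' subrr.
  ring.
rewrite (@orank_gfE _ m.+1) // -/S SE 2!coefsB 2!coefsD !coefs1.
(* The constant 3 only affects the coefficient of q^0. *)
have -> : (m == 0%N) = false by case: (m) m3.
rewrite !addr0 subr0; apply: laurent_dvdB => //.
have [g0 gs] := @coefs_prod_sparse laurent 3 m isT.
apply: (laurent_dvd_coefs_factor d 3 2 m T _ g0 gs) => // i im i3.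
have [h] := qpoch_Phi3_mod m; rewrite -/d -/D => hE.
pose V := \prod_(k < m) (1 - qvar ^+ k.+1) : fps laurent.
(* Factor 1 - Q^3 = (1 - Q)(1 + Q + Q^2): the quadratic factors multiply to [E - D * h], and [T * E]
   is a square. *)
have -> : T * \prod_(k < m) (1 - qvar ^+ (3 * k.+1)) =
    fpsC (1 + 1 + 1 + 1) *
      \prod_(k < m) ((1 + qvar ^+ k.+1) ^+ 2 * (1 - qvar ^+ k.+1)) -
    D * (T * h * V).
  have TE : T * E = qpoch (-1) qvar m.+1 ^+ 2.
    by rewrite divrK // unitrM !qpoch_unit.
  rewrite [\prod_(k < m) (1 - _ ^+ (3 * _))](_ : _ = V *
      \prod_(k < m) (1 + qvar ^+ k.+1 + (qvar ^+ k.+1) ^+ 2)); last first.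
    rewrite -big_split; apply: eq_bigr => k _ /=.
    by rewrite mulnC exprM; ring.
  (* The factor of index 0 is 2, whose square is the 4 above. *)
  have qpE : qpoch (-1) qvar m.+1 =
      (1 + 1) * \prod_(k < m) (1 + qvar ^+ k.+1) :> fps laurent.
    rewrite /qpoch big_ord_recl expr0 mulr1 opprK; congr (_ * _).
    by apply: eq_bigr => k _; rewrite mulN1r opprK.
  move/(canLR (addrK _)): hE => <-; rewrite mulrBr mulrBr -/E.
  rewrite mulrCA TE qpE big_split prodrXl /= -/V !fpsCD.
  have -> : fpsC 1 = 1 :> fps laurent by [].
  ring.
rewrite coefsB; apply: laurent_dvdB => //.
by rewrite coefsCM coefs_gauss // mulr0; exact: laurent_dvd0.
Qed.
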